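(* There exists a closed-valued mapping $g:[0,1]\to\mathbb R$ of the first Baire class such that $g$ is not the diagonal of any separately continuous closed-valued mapping $f:[0,1]^2\to\mathbb R$; that is, there is no separately continuous closed-valued mapping $f:[0,1]^2\to\mathbb R$ with $f(x,x)=g(x)$ for all $x\in[0,1]$.
   Context: A closed-valued mapping $f:X\to Y$ assigns to each $x\in X$ a nonempty closed subset $f(x)\subseteq Y$; it is regarded as a mapping into the space $\mathcal F(Y)$ of all nonempty closed subsets of $Y$ with the Vietoris topology. Such a (multi-valued) mapping is upper continuous at $x_0\in X$ if for every open $V\subseteq Y$ with $f(x_0)\subseteq V$ there is a neighborhood $U$ of $x_0$ with $f(x)\subseteq V$ for all $x\in U$; it is lower continuous at $x_0$ if for every open $V\subseteq Y$ with $f(x_0)\cap V\neq\emptyset$ there is a neighborhood $U$ of $x_0$ with $f(x)\cap V\neq\emptyset$ for all $x\in U$; it is continuous at $x_0$ if it is both upper and lower continuous at $x_0$. A mapping on $[0,1]^2$ is separately continuous if it is continuous (in this sense) with respect to each variable when the other one is fixed. A closed-valued mapping $g:[0,1]\to\mathbb R$ is of the first Baire class if, as a mapping $[0,1]\to\mathcal F(\mathbb R)$, it is the pointwise limit (in the Vietoris topology) of a sequence of continuous mappings $g_n:[0,1]\to\mathcal F(\mathbb R)$. *)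

(* Defs.v *)
From HB Require Import structures.
From mathcomp Require Import all_boot all_order all_algebra.
From mathcomp Require Import all_classical all_reals all_analysis.
Import numFieldNormedType.Exports.

Set Implicit Arguments.
Unset Strict Implicit.
Unset Printing Implicit Defensive.

Import Order.TTheory GRing.Theory Num.Theory.

Local Open Scope classical_set_scope.
Local Open Scope ring_scope.

Record hyperspace (Y : topologicalType) := Hyperspace {
  hyperset :> set Y ;
  hyperset_closed : closed hyperset ;
  hyperset_neq0 : hyperset !=set0 }.

Lemma hyperspace_eqP (Y : topologicalType) (A B : hyperspace Y) :
  A = B <-> A = B :> set Y.
Proof.
split=> [->//|]; case: A B => [A cA A0] [B cB B0] /= AB.
by rewrite AB in cA A0 *; congr Hyperspace; exact: Prop_irrelevance.
Qed.

(* Vietoris topology: the subbase consists of the sets {A | A `<=` V}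
   (index (true, V)) and {A | A meets V} (index (false, V)), V open in Y. *)
Definition vietoris_subbase (Y : topologicalType) (i : bool * set Y) :
    set (hyperspace Y) :=
  if i.1 then [set A : hyperspace Y | A `<=` i.2]
         else [set A : hyperspace Y | A `&` i.2 !=set0].

HB.instance Definition _ (Y : topologicalType) :=
  gen_eqMixin (hyperspace Y).
HB.instance Definition _ (Y : topologicalType) :=
  gen_choiceMixin (hyperspace Y).
HB.instance Definition _ (Y : topologicalType) :=
  @isSubBaseTopological.Build (hyperspace Y) (bool * set Y)%type
    [set i | open i.2] (@vietoris_subbase Y).

Lemma vietoris_cvgP (Y : topologicalType) (F : set_system (hyperspace Y))
    (A : hyperspace Y) : Filter F ->
  F --> A <->
  (forall V : set Y, open V -> A `<=` V ->
     \forall B \near F, (B : hyperspace Y) `<=` V) /\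
  (forall V : set Y, open V -> A `&` V !=set0 ->
     \forall B \near F, (B : hyperspace Y) `&` V !=set0).
Proof.
move=> FF; split=> [FA|[FU FL]].
  have sub (i : bool * set Y) : open i.2 -> vietoris_subbase i A ->
      F (vietoris_subbase i).
    move=> oi iA; apply: FA; apply: open_nbhs_nbhs; split=> //.
    exists [set vietoris_subbase i]; last by rewrite bigcup_set1.
    by move=> _ ->; exact: finI_from1.
  by split=> V oV AV; [exact: (sub (true, V))|exact: (sub (false, V))].
move=> W; rewrite nbhsE => -[U [[D sD DU] AU] UW].
apply: (filterS UW); move: AU; rewrite -DU => -[B DB BA].
apply: (@filterS _ _ _ B); first by move=> C BC; exists B.
have [E sE EB] := sD _ DB.
move: BA; rewrite -EB => BA; apply: filter_bigI => -[b V] EbV.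
have /set_mem/= oV := sE _ EbV.
have /= := BA _ EbV; rewrite /vietoris_subbase/=.
by case: b {EbV} => /= AV; [exact: FU|exact: FL].
Qed.

Section multivalued.
Variables X Y : topologicalType.
Implicit Types f g : X -> hyperspace Y.

Definition upper_continuous_at f (x0 : X) :=
  forall V : set Y, open V -> f x0 `<=` V -> \forall x \near x0, f x `<=` V.

Definition lower_continuous_at f (x0 : X) :=
  forall V : set Y, open V -> f x0 `&` V !=set0 ->
    \forall x \near x0, f x `&` V !=set0.

Definition mv_continuous f :=
  forall x0 : X, upper_continuous_at f x0 /\ lower_continuous_at f x0.

Lemma mv_continuousP f : mv_continuous f <-> continuous f.
Proof.
split=> cf x0; last by have /vietoris_cvgP[] := cf x0.
by have [? ?] := cf x0; apply/vietoris_cvgP.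
Qed.

Definition baire_one g :=
  exists g_ : nat -> X -> hyperspace Y,
    (forall n, continuous (g_ n)) /\ (forall x, g_ n x @[n --> \oo] --> g x).

End multivalued.

Definition separately_continuous (X1 X2 Y : topologicalType)
    (f : X1 * X2 -> hyperspace Y) :=
  (forall x1, mv_continuous (fun x2 => f (x1, x2))) /\
  (forall x2, mv_continuous (fun x1 => f (x1, x2))).

Notation unit_interval R := (set_type (`[(0 : R), (1 : R)]%classic)).

(* Main.v *)
(* The witness is the comb g(x) = {k + x/2 | k in nat}, the pointwise limit of its
   finite truncations. An upper continuous map cannot gain values at infinity:
   near x, the part of phi(y) beyond some bound is contained in phi(x). If f were
   separately continuous with diagonal g, each x would thus have an integer n
   such that, for |x - y| < 1/(n+1), the parts of f(x, y) and f(y, x) beyond n lie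
   in g(x). Since g(x) is discrete and intervals are connected, conversely the
   teeth of g(x) beyond n belong to f(x, y). As [0, 1] is uncountable, two distinct
   points x, y at distance < 1/(n+1) share the same n, so the teeth of g(x) beyond
   n lie in f(x, y), hence in g(y); but g(x) and g(y) are disjoint. *)
Require Import Defs.
From mathcomp Require Import all_boot all_order all_algebra.
From mathcomp Require Import all_classical all_reals all_analysis.
From mathcomp Require Import lra.
Import numFieldNormedType.Exports.
Import Order.TTheory GRing.Theory Num.Theory.
Local Open Scope classical_set_scope.
Local Open Scope ring_scope.

Lemma natr_dist_lt1_eq (R : realType) (m n : nat) :
  m%:R < n%:R + 1 :> R -> n%:R < m%:R + 1 :> R -> m = n.
Proof. by rewrite !natr1 !ltr_nat !ltnS => mn nm; apply/eqP; rewrite eqn_leq mn. Qed.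

Lemma finite_set_closed (R : realType) (A : set R) : finite_set A -> closed A.
Proof.
by move=> fA; apply: (accessible_finite_set_closed.1 _ _ fA);
  exact/hausdorff_accessible/Rhausdorff.
Qed.

(** Near any point [z] only finitely many terms of [u] occur, so a point of the closure of the range
    already lies in the closure of a finite set. *)
Lemma closed_range_cvgy (R : realType) (u : nat -> R) :
  u @ \oo --> +oo -> closed (range u).
Proof.
move=> /cvgryPgt uoo z clz.
have [N _ Nu] := uoo (z + 1).
have /finite_set_closed clF : finite_set (u @` `I_N).
  exact/finite_image/finite_II.
suff: (u @` `I_N) z by move=> [k _ <-]; exists k.
apply: clF => B zB.
have [] := clz (B `&` ball z 1).
  by apply: filterI => //; exact: nbhsx_ballx.
move=> _ [[k _ <-]] [Buk]; rewrite -ball_normE/= ltr_norml => /andP[zuk _].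
exists (u k); split => //; exists k => //=; rewrite ltnNge; apply/negP => Nk.
by have := Nu _ Nk; lra.
Qed.

(* Otherwise the witnesses [q n] of the failure at scale [1/(n+1)] form a
   closed set whose complement is a neighborhood of [phi x]. *)
Lemma upper_continuous_tail (R : realType) (phi : R -> hyperspace R) (x : R) :
  upper_continuous_at phi x ->
  exists n : nat, forall y : R, `|x - y| < n.+1%:R^-1 ->
    phi y `&` [set q | n%:R < q] `<=` phi x.
Proof.
move=> uphi; apply: contrapT => /forallNP bad.
have /choice[w wP] : forall n : nat, exists yq : R * R,
    [/\ `|x - yq.1| < n.+1%:R^-1, (phi yq.1 : set R) yq.2,
        n%:R < yq.2 & ~ (phi x : set R) yq.2].
  move=> n; have /existsNP[y] := bad n; rewrite not_implyE => -[xy].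
  move=> /existsNP[q]; rewrite not_implyE => -[[yq nq] xq].
  by exists (y, q).
have clq : closed (range (fun n => (w n).2)).
  apply: closed_range_cvgy; apply: (ger_cvgy _ (@cvgr_idn R)).
  by near=> n; have [_ _ /ltW] := wP n.
have := uphi _ (closed_openC clq); case=> [q xq [n _ qE]|e /= e0 He].
  by have [_ _ _] := wP n; rewrite qE.
have := near_infty_natSinv_lt (PosNum e0) => -[N _ /(_ N)]/= => /(_ (leqnn N)) Ne.
have [xy yq _ _] := wP N.
have := He _ (lt_trans xy Ne) _ yq; apply.
by exists N.
Unshelve. all: by end_near.
Qed.

Section comb.
Variable R : realType.
Implicit Types x y : R.

(** The slope 1/2 keeps the combs of distinct points of [0, 1] disjoint; with slope 1 those of 0 and
    1 would share teeth. *)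
Definition tooth (k : nat) x : R := k%:R + x / 2.

Lemma continuous_tooth k : continuous (tooth k).
Proof.
by move=> x; apply: cvgD; [exact: cvg_cst|apply: cvgM; [exact: cvg_id|exact: cvg_cst]].
Qed.

Lemma comb_closed x : closed (range (tooth ^~ x)).
Proof.
apply: closed_range_cvgy; rewrite /tooth.
apply/cvgryPge => A; near=> n.
have : A - x / 2 <= n%:R by near: n; exact: nbhs_infty_ger.
lra.
Unshelve. all: by end_near.
Qed.

Lemma comb_neq0 x : range (tooth ^~ x) !=set0.
Proof. by exists (tooth 0 x); exists 0%N. Qed.

Definition comb x : hyperspace R := Hyperspace (comb_closed x) (comb_neq0 x).

Lemma finite_comb_closed n x : closed ((tooth ^~ x) @` `I_n.+1).
Proof. by apply: finite_set_closed; apply: finite_image; exact: finite_II. Qed.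

Lemma finite_comb_neq0 n x : (tooth ^~ x) @` `I_n.+1 !=set0.
Proof. by exists (tooth 0 x); exists 0%N. Qed.

Definition finite_comb n x : hyperspace R :=
  Hyperspace (finite_comb_closed n x) (finite_comb_neq0 n x).

(** Upper continuity intersects one neighborhood per tooth, hence the truncation to finitely many
    teeth. *)
Lemma finite_comb_continuous n : continuous (finite_comb n).
Proof.
apply/mv_continuousP => x; split=> V oV /=.
  move=> xV; have VF (k : 'I_n.+1) : \forall y \near x, V (tooth k y).
    apply: continuous_tooth; apply: open_nbhs_nbhs; split=> //.
    by apply: xV; exists k => //=.
  near=> y => _ [k /= kn <-].
  have : forall k : 'I_n.+1, V (tooth k y) by near: y; exact: filter_forall.
  by move=> /(_ (Ordinal kn)).
move=> [_ [[k kn <-] Vk]].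
have : \forall y \near x, V (tooth k y).
  by apply: continuous_tooth; exact: open_nbhs_nbhs.
by apply: filterS => y Vy; exists (tooth k y); split=> //; exists k.
Unshelve. all: by end_near.
Qed.

Lemma finite_comb_cvg x : finite_comb n x @[n --> \oo] --> comb x.
Proof.
apply/vietoris_cvgP; split=> V oV /=.
  move=> xV; rewrite near_map; apply: nearW => n _ [k _ <-].
  by apply: xV; exists k.
move=> [_ [[k _ <-] Vk]]; rewrite near_map; near=> n; exists (tooth k x); split=> //.
by exists k => //=; rewrite ltnS; near: n; exact: nbhs_infty_ge.
Unshelve. all: by end_near.
Qed.

(* Within the tail bound, [tooth j x] is isolated in [phi y], so both
   semicontinuities make [{y | phi y (tooth j x)}] relatively clopen. *)
Lemma tooth_persists (phi : R -> hyperspace R) x n j :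
  mv_continuous phi -> phi x = comb x -> 0 <= x -> (n < j)%N ->
  (forall y, `|x - y| < n.+1%:R^-1 ->
    phi y `&` [set q | n%:R < q] `<=` phi x) ->
  forall y, `|x - y| < n.+1%:R^-1 -> (phi y : set R) (tooth j x).
Proof.
move=> cphi phix x0 nj tail.
(* Radius 1/2 keeps [V] above [n], since [n + 1 <= j] and [0 <= x], and away from the other teeth at
   [x], which are spaced by 1. On [A], meeting [V] thus amounts to containing [p]. *)
set p := tooth j x; pose A := ball x n.+1%:R^-1; pose V := ball p 2^-1.
have r0 : 0 < n.+1%:R^-1 :> R by rewrite invr_gt0.
have oV : open V by apply: ball_open; lra.
have VP y : A y -> (phi y `&` V !=set0) = (phi y : set R) p.
  move=> Ay; apply/propext; split=> [[q [yq Vq]]|yp]; last first.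
    by exists p; split=> //; apply: ballxx; lra.
  suff <- : q = p by [].
  move: Vq; rewrite /V -ball_normE/= ltr_norml => /andP[q1 q2].
  have njR : n%:R + 1 <= j%:R :> R by rewrite natr1 ler_nat.
  have : (phi x : set R) q.
    apply: (tail y); first by move: Ay; rewrite /A -ball_normE.
    by split=> //=; move: q1 q2; rewrite /p /tooth; lra.
  rewrite phix => -[k _ kq]; rewrite -kq /p; congr (tooth _ x).
  move: q1 q2; rewrite -kq /p /tooth => q1 q2.
  by apply: (@natr_dist_lt1_eq R); lra.
have cA : connected A.
  by apply/connected_intervalP; rewrite /A ball_itv; exact: interval_is_interval.
have Ax : A x by exact: ballxx.
suff AE : A `&` [set y | (phi y : set R) p] = A.
  move=> y xy; have : A y by rewrite /A -ball_normE.
  by rewrite -AE => -[].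
apply: cA.
- by exists x; split=> //=; rewrite phix; exists j.
- exists [set y | phi y `&` V !=set0].
    by rewrite openE => y Vy; exact: (cphi y).2.
  by apply/seteqP; split=> y [Ay]/=; [rewrite -VP|rewrite VP].
- exists [set y | (phi y : set R) p] => //.
  rewrite -[X in closed X]setCK; apply: open_closedC; rewrite openE => y /= yp.
  have cp : closed [set p] by exact: finite_set_closed.
  have phiyp : phi y `<=` ~` [set p] by move=> q yq qp; apply: yp; rewrite -qp.
  have := (cphi y).1 _ (closed_openC cp) phiyp.
  by apply: filterS => z zp /zp; exact.
Qed.

End comb.

(** Each interval [k r, (k + 1) r) holds at most one point of [E], so the integer part of [x / r] is
    injective on [E]. *)
Lemma countable_separated (R : realType) (r : R) (E : set R) :
  0 < r -> (forall x, E x -> 0 <= x) ->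
  (forall x y, E x -> E y -> `|x - y| < r -> x = y) -> countable E.
Proof.
move=> r0 E0 sepE; apply/countable_injP.
exists (fun x => Num.trunc (x / r)) => x y /set_mem Ex /set_mem Ey xy.
apply: sepE => //.
have /andP[x1 x2] := truncn_itv (divr_ge0 (E0 _ Ex) (ltW r0)).
have /andP[y1 y2] := truncn_itv (divr_ge0 (E0 _ Ey) (ltW r0)).
rewrite -[ltRHS]mul1r -ltr_pdivrMr// -[X in _ / X](gtr0_norm r0) -normf_div.
rewrite ltr_norml mulrBl; move: x1 x2 y1 y2; rewrite xy -natr1.
lra.
Qed.

Lemma uncountable_unit_interval (R : realType) :
  ~ countable (`[0, 1]%classic : set R).
Proof.
move=> /countable_lebesgue_measure0; rewrite lebesgue_measure_itv/= lte01.
by rewrite sube0 => /eqP; rewrite onee_eq0.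
Qed.

(** Retraction of the line onto [0, 1]; it extends [f] to the plane, so that balls and intervals can
    be taken in [R]. *)
Definition clamp (R : realType) (t : R) : R := Num.max 0 (Num.min 1 t).

Lemma clamp_subproof (R : realType) (t : R) :
  clamp R t \in `[(0 : R), 1]%classic.
Proof.
by apply/mem_set; rewrite /= in_itv/= /clamp le_max lexx ge_max ler01 ge_min lexx.
Qed.

Definition unit_clamp (R : realType) (t : R) : unit_interval R :=
  exist _ (clamp R t) (clamp_subproof R t).

Lemma unit_clamp_continuous (R : realType) : continuous (@unit_clamp R).
Proof.
apply: continuous_comp_initial => t.
have cmin : {for t, continuous ((cst 1 : R -> R^o) \min idfun)}.
  by apply: continuous_min; [exact: cvg_cst|exact: cvg_id].
exact: continuous_max (cvg_cst (0 : R^o)) cmin.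
Qed.

Lemma val_unit_clamp (R : realType) (t : R) : 0 <= t <= 1 ->
  val (unit_clamp R t) = t.
Proof. by move=> /andP[t0 t1]; rewrite /= /clamp min_r// max_r. Qed.

Theorem proposition4p2 (R : realType) :
  exists g : unit_interval R -> hyperspace R,
    baire_one g /\
    ~ exists f : unit_interval R * unit_interval R -> hyperspace R,
        separately_continuous f /\ (forall x : unit_interval R, f (x, x) = g x).
Proof.
exists (comb R \o val); split.
  exists (fun n => finite_comb R n \o val); split=> [n x|x]; last exact: finite_comb_cvg.
  apply: continuous_comp; last exact: finite_comb_continuous.
  exact: initial_continuous.
move=> [f [[fr fl] fd]].
pose F s t := f (unit_clamp R s, unit_clamp R t).
have cFr s : mv_continuous (F s).
  apply/mv_continuousP => t.
  apply: (@continuous_comp _ _ _ (unit_clamp R) (fun v => f (unit_clamp R s, v))).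
    exact: unit_clamp_continuous.
  by have /mv_continuousP := fr (unit_clamp R s); exact.
have cFl t : mv_continuous (F ^~ t).
  apply/mv_continuousP => s.
  apply: (@continuous_comp _ _ _ (unit_clamp R) (fun v => f (v, unit_clamp R t))).
    exact: unit_clamp_continuous.
  by have /mv_continuousP := fl (unit_clamp R t); exact.
have Fd t : 0 <= t <= 1 -> F t t = comb R t.
  by move=> t01; rewrite /F fd; congr comb; exact: val_unit_clamp.
(* For the final pair, the first half at [x] carries a tooth of [x] into [F x y], and the second
   half at [y] carries it on into [F y y]. *)
pose tail n x := (forall y, `|x - y| < n.+1%:R^-1 ->
    F x y `&` [set q | n%:R < q] `<=` F x x) /\
  (forall y, `|x - y| < n.+1%:R^-1 ->
    F y x `&` [set q | n%:R < q] `<=` F x x).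
have tailP x : exists n, tail n x.
  have [n1 H1] := upper_continuous_tail _ _ _ (cFr x x).1.
  have [n2 H2] := upper_continuous_tail _ (F ^~ x) _ (cFl x x).1.
  have le_inv m : (m <= maxn n1 n2)%N -> (maxn n1 n2).+1%:R^-1 <= m.+1%:R^-1 :> R.
    by move=> mn; rewrite lef_pV2 ?posrE// ler_nat ltnS.
  (* A larger index shrinks the radius and raises the threshold, so both bounds survive. *)
  exists (maxn n1 n2); split=> y xy q [yq nq]; [apply: (H1 y)|apply: (H2 y)].
  - by apply: (lt_le_trans xy); apply: le_inv; rewrite leq_maxl.
  - by split=> //; apply: le_lt_trans nq; rewrite ler_nat leq_maxl.
  - by apply: (lt_le_trans xy); apply: le_inv; rewrite leq_maxr.
  - by split=> //; apply: le_lt_trans nq; rewrite ler_nat leq_maxr.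
apply: (@uncountable_unit_interval R).
have -> : `[0, 1]%classic = \bigcup_n [set x : R | 0 <= x <= 1 /\ tail n x].
  apply/seteqP; split=> x; rewrite /= in_itv/=; last by move=> [n _ []].
  by move=> x01; have [n] := tailP x; exists n.
apply: bigcup_countable => // n _.
apply: (countable_separated R n.+1%:R^-1) => [|x [/andP[]//]|]; first by rewrite invr_gt0.
move=> x y [x01 [xt _]] [y01 [_ yt]] xy.
have Fxy : (F x y : set R) (tooth R n.+1 x).
  by apply: (@tooth_persists R (F x) x n n.+1) => //; [exact: Fd|case/andP: x01].
have : (F y y : set R) (tooth R n.+1 x).
  apply: (yt x); first by rewrite distrC.
  by split=> //=; rewrite /tooth; lra.
rewrite Fd// => -[k _]; rewrite /tooth => kE.
have xy1 : `|x - y| < 1.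
  by apply: (lt_le_trans xy); rewrite invf_le1// ler1n.
move: xy1; rewrite ltr_norml => /andP[xy1 xy2].
(* The common tooth gives [k - (n + 1) = (x - y) / 2], of modulus below 1. *)
have kn : k = n.+1 by apply: (@natr_dist_lt1_eq R); lra.
by move: kE; rewrite kn; lra.
Qed.
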